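(* Let $n\ge 5$ and let $F$ be a subgraph of the convex complete graph $K_n$ such that $|E(F)|=n-1$ and $F$ contains no boundary edge of $K_n$. Then $K_n-F$ admits a triangulation unless $F$ has configuration $\mathcal{J}_n( * )$ of Type-1 or of Type-2.
   Context: A convex complete graph $K_m$ is the complete graph on $m$ points in convex position in the plane, edges drawn as straight-line segments; vertices labelled $v_0,\dots,v_{m-1}$ are in cyclic order along the convex hull boundary, subscripts mod $m$. Boundary edges join boundary-consecutive vertices. Two edges with four distinct endpoints cross if their endpoints alternate along the boundary. $K_m-F$ is obtained from $K_m$ by deleting the edges of $F$ (all vertices kept). A convex graph on $m$ vertices admits a triangulation if it contains all $m$ boundary edges and $m-3$ pairwise non-crossing diagonals. $d_F(v)$ is the degree in $F$; pendant vertex = degree $1$ in $F$. Configuration $\mathcal{F}_m( * )$ ($m\ge4$): $F\subseteq K_m$ has exactly $m-2$ edges, no isolated vertices, and for some cyclic labelling either (a) $E(F)=\{v_0v_i:2\le i\le m-2\}\cup\{v_1v_{m-1}\}$, or (b) for some $2\le k\le m-4$: (i) for $0\le i\le k-1$, $d_F(v_i)\ge2$ and $v_{i-1}v_{i+1}\in E(F)$; (ii) for $k\le i\le m-1$, $d_F(v_i)=1$ and $v_i$'s neighbour in $F$ is non-pendant; (iii) if pendant vertices $u,v$ have crossing $F$-edges $uv_i$, $vv_j$, then $|i-j|=1$. Configuration $\mathcal{J}_m( * )$ ($m\ge5$): $F\subseteq K_m$ has exactly $m-1$ edges, no isolated vertices, and (i) every vertex $v_i$ with $v_{i-1}v_{i+1}\notin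 E(F)$ has $d_F(v_i)\le 2$; (ii) if $v_{i-1}v_{i+1}\notin E(F)$ and $d_F(v_i)=2$, then $F-v_i$, viewed as a subgraph of the convex complete graph $K_m-v_i$ on the remaining $m-1$ vertices (inherited cyclic order), has configuration $\mathcal{F}_{m-1}( * )$. For $k\in\{1,2\}$, $J_{m,k}$ is the set of vertices $v_i$ with $d_F(v_i)=k$ and $v_{i-1}v_{i+1}\notin E(F)$. A $\mathcal{J}_m( * )$ configuration is of Type-1 if $J_{m,2}=\emptyset$ and there is an edge $e$ of $F$ such that $F-e$ has configuration $\mathcal{F}_m( * )$. It is of Type-2 if $J_{m,2}\ne\emptyset$ and whenever $v_i\in J_{m,2}$ has $F$-neighbours $v_{j_1},v_{j_2}$ and $v_t$ is a pendant vertex of $F$ with $F$-neighbour $v_s$ such that $v_tv_s$ crosses both $v_iv_{j_1}$ and $v_iv_{j_2}$, then $|j_1-s|=1$ or $|j_2-s|=1$. *)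

(* Defs.v *)
From mathcomp Require Import all_boot.

Set Implicit Arguments.
Unset Strict Implicit.
Unset Printing Implicit Defensive.

(* The m points in convex position are 'I_m, in the cyclic order of their
   values along the convex hull; the boundary neighbours of i are [ord_pred i]
   and [ordS i].  An edge is a two-element set of vertices, and a graph is its
   set of edges, its vertex set always being all of 'I_m. *)

Definition convex_complete (m : nat) : {set {set 'I_m}} :=
  [set e : {set 'I_m} | #|e| == 2].

Definition boundary (m : nat) : {set {set 'I_m}} :=
  [set [set i; ordS i] | i : 'I_m].

Definition consecutive (m : nat) (i j : 'I_m) : Prop := j = ordS i \/ i = ordS j.

(* With the endpoints sorted by value, alternation along the boundary means
   that one edge takes the first and third, the other the second and fourth. *)
Definition crossing (m : nat) (e f : {set 'I_m}) : Prop :=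
  exists a b c d : 'I_m,
    [/\ a < b, b < c, c < d &
        (e = [set a; c] /\ f = [set b; d]) \/
        (e = [set b; d] /\ f = [set a; c])].

Definition admits_triangulation (m : nat) (G : {set {set 'I_m}}) : Prop :=
  boundary m \subset G /\
  exists T : {set {set 'I_m}},
    [/\ T \subset G :\: boundary m,
        #|T| = m - 3 &
        forall e f : {set 'I_m}, e \in T -> f \in T -> ~ crossing e f].

Definition deg (m : nat) (F : {set {set 'I_m}}) (x : 'I_m) : nat :=
  #|[set e in F | x \in e]|.

Definition no_isolated (m : nat) (F : {set {set 'I_m}}) : Prop :=
  forall x : 'I_m, 0 < deg F x.

Definition pendant (m : nat) (F : {set {set 'I_m}}) (x : 'I_m) : Prop :=
  deg F x = 1.

(* A labelling is indexed by all of nat, so that it is periodic of period m: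
   subscripts are read modulo m, and v_{i-1} is [v (i + m.-1)].  Both
   orientations of the boundary are allowed. *)
Definition cyclic_labelling (m : nat) (v : nat -> 'I_m) : Prop :=
  (forall i : nat, v i.+1 = ordS (v i)) \/
  (forall i : nat, v i.+1 = ord_pred (v i)).

Definition config_F_a (m : nat) (F : {set {set 'I_m}}) (v : nat -> 'I_m) : Prop :=
  forall e : {set 'I_m},
    e \in F <->
    (exists i : nat, 2 <= i <= m - 2 /\ e = [set v 0; v i]) \/
    e = [set v 1; v (m - 1)].

Definition config_F_b (m : nat) (F : {set {set 'I_m}}) (v : nat -> 'I_m) : Prop :=
  exists k : nat,
    [/\ 2 <= k <= m - 4,
        (forall i : nat, i <= k - 1 ->
           2 <= deg F (v i) /\ [set v (i + m.-1); v i.+1] \in F),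
        (forall i : nat, k <= i <= m - 1 ->
           pendant F (v i) /\
           forall w : 'I_m, [set v i; w] \in F -> ~ pendant F w) &
        forall (u w : 'I_m) (i j : nat), i < m -> j < m ->
          pendant F u -> pendant F w ->
          [set u; v i] \in F -> [set w; v j] \in F ->
          crossing [set u; v i] [set w; v j] ->
          i = j.+1 \/ j = i.+1].

Definition config_F (m : nat) (F : {set {set 'I_m}}) : Prop :=
  [/\ 4 <= m, F \subset convex_complete m, #|F| = m - 2, no_isolated F &
      exists v : nat -> 'I_m,
        cyclic_labelling v /\ (config_F_a F v \/ config_F_b F v)].

(* [lift x] is the increasing enumeration of the vertices other than x, so the
   remaining vertices keep their inherited cyclic order. *)
Definition delete_vertex (m : nat) (F : {set {set 'I_m}}) (x : 'I_m) :
    {set {set 'I_m.-1}} :=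
  [set e : {set 'I_m.-1} | lift x @: e \in F].

Definition spanned (m : nat) (F : {set {set 'I_m}}) (x : 'I_m) : Prop :=
  [set ord_pred x; ordS x] \in F.

Definition config_J (m : nat) (F : {set {set 'I_m}}) : Prop :=
  [/\ 5 <= m, F \subset convex_complete m, #|F| = m - 1, no_isolated F &
      forall x : 'I_m, ~ spanned F x ->
        deg F x <= 2 /\ (deg F x = 2 -> config_F (delete_vertex F x))].

Definition in_J (m : nat) (F : {set {set 'I_m}}) (k : nat) (x : 'I_m) : Prop :=
  deg F x = k /\ ~ spanned F x.

Definition J_type1 (m : nat) (F : {set {set 'I_m}}) : Prop :=
  [/\ config_J F,
      (forall x : 'I_m, ~ in_J F 2 x) &
      exists e : {set 'I_m}, e \in F /\ config_F (F :\ e)].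

(* No labelling is fixed here and subscripts are read modulo m, so a
   difference of 1 between two subscripts means boundary-consecutive. *)
Definition J_type2 (m : nat) (F : {set {set 'I_m}}) : Prop :=
  [/\ config_J F,
      (exists x : 'I_m, in_J F 2 x) &
      forall x y1 y2 t s : 'I_m,
        in_J F 2 x -> y1 != y2 ->
        [set x; y1] \in F -> [set x; y2] \in F ->
        pendant F t -> [set t; s] \in F ->
        crossing [set t; s] [set x; y1] -> crossing [set t; s] [set x; y2] ->
        consecutive y1 s \/ consecutive y2 s].

(* Main.v *)
(* Call a vertex spanned when the diagonal joining its two boundary neighbours
   lies in F.  An unspanned vertex x can be cut off as an ear, so K_n - F is
   triangulable as soon as K_{n-1} - (F - x) is; by induction at most n - 3
   deleted diagonals never destroy all triangulations.  Triangulations are also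
   obtained from a triangle u, p, w by filling each of its three outer arcs with
   a fan.  This handles isolated vertices, crossing pendant edges whose other
   ends are not consecutive, and pendant vertices u, w whose neighbours lie on
   opposite sides of the chord uw.

   Suppose now that there is no triangulation and |F| is n - 2 or n - 1.  If every
   unspanned vertex is pendant, the last case applied to two vertices each
   followed by a spanned vertex shows that the spanned vertices form a single
   arc; the edges at unspanned vertices and those spanning a vertex are then
   exactly n - 2 and form a configuration F_n( * ).  For |F| = n - 2 this
   is all of F; for |F| = n - 1 with J_{n,2} empty there is one further edge
   and F is of Type-1.  If J_{n,2} is not empty, the crossing condition of Type-2
   is the consecutiveness forced by the fans. *)
Require Import Defs.
From mathcomp Require Import all_boot zify.
From Stdlib Require Import Classical.

Set Implicit Arguments.
Unset Strict Implicit.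
Unset Printing Implicit Defensive.

(** * Cyclic order *)

(** [b] lies strictly inside the arc from [a] to [c] in the direction of [ordS]. *)
Definition cyc (n : nat) (a b c : 'I_n) : bool :=
  [|| a < b < c, b < c < a | c < a < b].

Lemma ord_eqE n (i j : 'I_n) : (i == j) = (i == j :> nat).
Proof. by []. Qed.

Lemma ordS_spec n (i : 'I_n) :
  i < n /\ (i.+1 = n /\ ordS i = 0 :> nat \/ i.+1 < n /\ ordS i = i.+1 :> nat).
Proof.
have lt := ltn_ord i; split=> //=; case: (ltngtP i.+1 n) => [lt'||eq]; last 1 first.
- by left; rewrite eq modnn.
- by right; rewrite modn_small.
- lia.
Qed.

Lemma ord_pred_spec n (i : 'I_n) :
  i < n /\ (i = 0 :> nat /\ (ord_pred i).+1 = n :> nat \/ i = (ord_pred i).+1 :> nat).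
Proof.
have lt := ltn_ord i; split=> //=; case: (posnP i) => [->|pos].
  by left; rewrite modn_small //; lia.
right; have -> : (i + n).-1 = n + i.-1 by lia.
rewrite modnDl modn_small //; lia.
Qed.

Lemma lift_spec n (x : 'I_n) (i : 'I_n.-1) :
  (i < x /\ lift x i = i :> nat) \/ (x <= i /\ lift x i = i.+1 :> nat).
Proof. rewrite /= /bump; lia. Qed.

(* Reduces a goal about cyclically ordered vertices to linear arithmetic on their
   values; of the context only inequalities between naturals are used. *)
Ltac ord_lia :=
  rewrite /cyc ?ord_eqE;
  repeat match goal with
  | |- context [nat_of_ord (ordS ?i)] =>
      move: (ordS_spec i); move: (nat_of_ord (ordS i)) => ?
  | |- context [nat_of_ord (lift ?x ?i)] =>
      move: (lift_spec x i); move: (nat_of_ord (lift x i)) => ?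
  | |- context [nat_of_ord (ord_pred ?i)] =>
      move: (ord_pred_spec i); move: (nat_of_ord (ord_pred i)) => ?
  end;
  repeat match goal with
  | |- context [nat_of_ord ?i] =>
      move: (ltn_ord i); move: (nat_of_ord i) => ?
  end;
  repeat match goal with
  | H : is_true (leq _ _) |- _ => revert H
  | H : _ |- _ => clear H
  end;
  intros; lia.

(* [lia] is slow in large contexts, so only the order hypotheses on naturals are
   kept. *)
Ltac nat_lia :=
  repeat match goal with
  | H : ?T |- _ =>
      lazymatch T with
      | nat => fail
      | @eq nat _ _ => fail
      | is_true (leq _ _) => fail
      | is_true (andb (leq _ _) (leq _ _)) => fail
      | is_true (negb (@eq_op _ ?a _)) =>
          let t := type of a in tryif unify t nat then fail else clear H
      | _ => clear H
      end
  end; lia.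

Lemma cyc_lift n (x : 'I_n) (a b c : 'I_n.-1) :
  cyc (lift x a) (lift x b) (lift x c) = cyc a b c.
Proof. ord_lia. Qed.

Lemma lift_ordS n (x : 'I_n) (i j : 'I_n.-1) :
  lift x j == ordS (lift x i) -> j == ordS i.
Proof. ord_lia. Qed.

Lemma lift_ear n (x : 'I_n) (i j : 'I_n.-1) : 
  lift x i == ord_pred x -> lift x j == ordS x -> j == ordS i.
Proof. ord_lia. Qed.

Lemma lift_ordS_or_ear n (x : 'I_n) (i : 'I_n.-1) :
  2 < n -> (lift x (ordS i) == ordS (lift x i)) ||
    (ord_pred x == lift x i) && (ordS x == lift x (ordS i)).
Proof. ord_lia. Qed.

(** * Edges as pairs of vertices, and deletion of a vertex *)

Lemma set2_eq (T : finType) (a b c d : T) :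
  [set a; b] = [set c; d] -> a = c /\ b = d \/ a = d /\ b = c.
Proof.
move=> E; have := set21 a b; have := set22 a b; have := set21 c d; have := set22 c d.
by rewrite -{1 2}E {3 4}E => /set2P[] ? /set2P[] ? /set2P[] ? /set2P[] ?; subst; auto.
Qed.

(** Trades sorted endpoints for a condition that is invariant under rotation. *)
Lemma crossingP n (x y z w : 'I_n) :
  crossing [set x; y] [set z; w] ->
  cyc x z y && cyc y w x || cyc x w y && cyc y z x.
Proof.
move=> [a [b [c [d [ab bc cd E]]]]].
case: E => -[/set2_eq[] [? ?] /set2_eq[] [? ?]]; subst; rewrite /cyc; lia.
Qed.

Lemma edge_pair n (x y : 'I_n) : ([set x; y] \in convex_complete n) = (x != y).
Proof. by rewrite inE cards2; case: (x != y). Qed.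

Lemma boundary_pair n (x y : 'I_n) :
  ([set x; y] \in boundary n) = (y == ordS x) || (x == ordS y).
Proof.
apply/imsetP/orP => [[i _ /set2_eq[[-> ->]|[-> ->]]]|[/eqP->|/eqP->]].
- by left.
- by right.
- by exists x.
- by exists y; rewrite // setUC.
Qed.

Lemma edgeP n (e : {set 'I_n}) :
  e \in convex_complete n -> exists x y, x != y /\ e = [set x; y].
Proof. by rewrite inE => /cards2P[x [y [ne ->]]]; exists x, y. Qed.

Lemma delete_pair n (F : {set {set 'I_n}}) x (a b : 'I_n.-1) :
  ([set a; b] \in delete_vertex F x) = ([set lift x a; lift x b] \in F).
Proof. by rewrite inE imsetU1 imset_set1. Qed.

Lemma unliftE n (x u : 'I_n) : u != x -> exists u', u = lift x u'.
Proof. by rewrite eq_sym => /unlift_some[u' ->]; exists u'. Qed.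

Lemma lift_preimset n (x : 'I_n) (e : {set 'I_n}) :
  x \notin e -> e = lift x @: (lift x @^-1: e).
Proof.
move=> xe; apply/setP => y; apply/idP/imsetP => [ye|[z]]; last first.
  by rewrite inE => ? ->.
have [|z yE] := @unliftE _ x y; first by apply: contraNneq xe => <-.
by exists z; rewrite ?inE -?yE.
Qed.

Lemma delete_sub n (F : {set {set 'I_n}}) x :
  F \subset convex_complete n -> delete_vertex F x \subset convex_complete n.-1.
Proof.
move=> /subsetP sF; apply/subsetP => e; rewrite inE => /sF; rewrite !inE.
by rewrite card_imset //; apply: lift_inj.
Qed.

(** The one boundary edge of the smaller polygon that is not a boundary edge of the larger is the
    chord spanning [x]. *)
Lemma delete_disjoint n (F : {set {set 'I_n}}) x :
  2 < n -> [disjoint F & boundary n] -> ~ spanned F x ->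
  [disjoint delete_vertex F x & boundary n.-1].
Proof.
move=> n2 dF sx; rewrite disjoint_sym; apply/pred0P => e /=; apply/andP => -[].
case/imsetP => i _ ->; rewrite delete_pair => iF.
case/orP: (lift_ordS_or_ear x i n2) => [/eqP E|/andP[/eqP E1 /eqP E2]].
  by move: (disjointFr dF iF); rewrite boundary_pair E eqxx.
by apply: sx; rewrite /spanned E1 E2.
Qed.

Lemma card_delete n (F : {set {set 'I_n}}) x :
  #|delete_vertex F x| = #|F| - deg F x.
Proof.
have -> : #|F| = deg F x + #|[set e in F | x \notin e]|.
  rewrite /deg -(cardsID [set e : {set 'I_n} | x \in e] F); congr (_ + _).
    by apply: eq_card => e; rewrite !inE.
  by apply: eq_card => e; rewrite !inE andbC.
rewrite addKn -(card_imset _ (imset_inj (@lift_inj _ x))).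
apply: eq_card => e; apply/imsetP/idP.
  move=> [e']; rewrite !inE => H ->; rewrite H /=.
  by apply/imsetP => -[y _] /eqP; rewrite (negbTE (neq_lift _ _)).
rewrite inE => /andP[eF xe]; exists (lift x @^-1: e).
  by rewrite inE -lift_preimset.
exact: lift_preimset.
Qed.

Lemma crossing_sym n (e f : {set 'I_n}) : crossing e f -> crossing f e.
Proof. by move=> [a [b [c [d [? ? ? [[]|[]]]]]]]; exists a, b, c, d; split; auto. Qed.

Lemma crossing_ear n (x : 'I_n) (e : {set 'I_n}) :
  crossing [set ord_pred x; ordS x] e -> x \in e.
Proof.
move=> X; have [z [w E]] : exists z w, e = [set z; w].
  by case: X => [a [b [c [d [_ _ _ [[_ ->]|[_ ->]]]]]]]; [exists b, d|exists a, c].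
move: X; rewrite E !inE => /crossingP; ord_lia.
Qed.

Lemma crossing_lift n (x : 'I_n) (e f : {set 'I_n.-1}) :
  crossing (lift x @: e) (lift x @: f) -> crossing e f.
Proof.
move=> [a [b [c [d [ab bc cd E]]]]].
have im y : y \in [set a; b; c; d] -> exists y', y = lift x y'.
  move=> yE; have : y \in lift x @: e :|: lift x @: f.
    by case: E yE => -[-> ->]; rewrite !inE => /orP[/orP[/orP[]|]|] ->; rewrite ?orbT.
  by rewrite -imsetU => /imsetP[y' _ ->]; exists y'.
have [a' Ea] : exists y', a = lift x y' by apply: im; rewrite !inE eqxx.
have [b' Eb] : exists y', b = lift x y' by apply: im; rewrite !inE eqxx ?orbT.
have [c' Ec] : exists y', c = lift x y' by apply: im; rewrite !inE eqxx ?orbT.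
have [d' Ed] : exists y', d = lift x y' by apply: im; rewrite !inE eqxx ?orbT.
exists a', b', c', d'; subst; split; try by [move: ab; ord_lia|move: bc; ord_lia|move: cd; ord_lia].
have linj := imset_inj (@lift_inj _ x).
by case: E => -[E1 E2]; [left|right]; split; apply: linj;
  rewrite ?E1 ?E2 imsetU1 imset_set1.
Qed.

Definition triangulable n (F : {set {set 'I_n}}) : Prop :=
  admits_triangulation (convex_complete n :\: F).

(** The chord joining the boundary neighbours of [x] is added to the transported triangulation; no
    edge avoiding [x] crosses it. *)
Lemma ear_triangulable n (F : {set {set 'I_n}}) (x : 'I_n) :
  3 < n -> [disjoint F & boundary n] -> ~ spanned F x ->
  triangulable (delete_vertex F x) -> triangulable F.
Proof.
move=> n3 dF sx [_ [T [sT cT nT]]]; split.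
  apply/subsetP => e eb; rewrite in_setD (disjointFl dF eb) /=.
  case/imsetP: eb => i _ ->; rewrite edge_pair; ord_lia.
(* The ear chord is a boundary edge of the smaller polygon, hence not in [T], so adding it raises
   the count to [n - 3]. *)
have earP e : e \in T -> lift x @: e != [set ord_pred x; ordS x].
  move=> eT; apply/eqP => E.
  move/subsetP/(_ _ eT): sT; rewrite !in_setD => /and3P[eb _ /edgeP[a [b [ab eE]]]].
  move: E eb; rewrite eE imsetU1 imset_set1 boundary_pair.
  case/set2_eq => -[/eqP Ea /eqP Eb]; first by rewrite (lift_ear Ea Eb).
  by rewrite (lift_ear Eb Ea) orbT.
have xl (e : {set 'I_n.-1}) : x \notin lift x @: e.
  by apply/imsetP => -[y _] /eqP; rewrite (negbTE (neq_lift _ _)).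
exists ([set ord_pred x; ordS x] |: [set lift x @: e | e : {set 'I_n.-1} in T]).
split.
- apply/subsetP => e /setU1P[->|/imsetP[e' eT ->]].
    rewrite !in_setD edge_pair boundary_pair; apply/and3P; split; [ord_lia| |ord_lia].
    exact/negP.
  move/subsetP/(_ _ eT): (sT); rewrite !in_setD => /and3P[eb eF /edgeP[a [b [ab eE]]]].
  move: eb eF; rewrite eE imsetU1 imset_set1 delete_pair !boundary_pair edge_pair => eb -> /=.
  rewrite (inj_eq lift_inj) ab andbT; apply: contra eb.
  by case/orP => /lift_ordS ->; rewrite ?orbT.
- rewrite cardsU1 card_imset; last exact/imset_inj/lift_inj.
  rewrite cT; case: imsetP => [[e eT /esym/eqP]|_]; last by lia.
  by rewrite (negbTE (earP e eT)).
- move=> e f /setU1P[->|/imsetP[e' eT ->]] /setU1P[->|/imsetP[f' fT ->]].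
  + move=> /crossing_ear; rewrite !inE; ord_lia.
  + by move=> /crossing_ear; rewrite (negbTE (xl _)).
  + by move=> /crossing_sym/crossing_ear; rewrite (negbTE (xl _)).
  + by move/crossing_lift; apply: nT.
Qed.

(** * Constructing triangulations *)

(** One of [x], [y] can be the apex of a fan: its chords to the open arc from [x] to [y] avoid
    [F]. *)
Definition fan n (F : {set {set 'I_n}}) (x y : 'I_n) : Prop :=
  (forall q, cyc x q y -> [set x; q] \notin F) \/
  (forall q, cyc x q y -> [set y; q] \notin F).

Lemma triangulable3 (F : {set {set 'I_3}}) :
  [disjoint F & boundary 3] -> triangulable F.
Proof.
move=> dF; split; last first.
  by exists set0; split; rewrite ?sub0set ?cards0 // => e f; rewrite inE.
apply/subsetP => e eb; rewrite in_setD (disjointFl dF eb) /=.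
case/imsetP: eb => i _ ->; rewrite edge_pair; ord_lia.
Qed.

Lemma fan_delete n (F : {set {set 'I_n}}) x a b :
  fan F (lift x a) (lift x b) -> fan (delete_vertex F x) a b.
Proof.
by case=> H; [left|right] => q qc; rewrite delete_pair H // cyc_lift.
Qed.

Lemma fourth_point n (u p w : 'I_n) :
  3 < n -> exists t, [/\ t != u, t != p & t != w].
Proof.
move=> n3; have : 0 < #|~: (w |: [set u; p])|.
  have := cardsC (w |: [set u; p]); rewrite card_ord cardsU1 cards2.
  by case: (_ \notin _) (u != p) => -[] /=; lia.
by case/card_gt0P => x; rewrite !inE !negb_or => /and3P[? ? ?]; exists x.
Qed.

(** Induction replaces writing the fans down: while a fourth vertex exists, one of the three arcs is
    non-empty, an ear is cut off inside it, and the fan conditions survive the deletion. *)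
Lemma three_fan n (F : {set {set 'I_n}}) (u p w : 'I_n) :
  [disjoint F & boundary n] -> cyc u p w ->
  [set u; p] \notin F -> [set p; w] \notin F -> [set w; u] \notin F ->
  fan F u p -> fan F p w -> fan F w u -> triangulable F.
Proof.
elim: n F u p w => [F [] //|n IH F u p w dF upw up pw wu fup fpw fwu].
have n2 : 2 < n.+1 by move: upw; ord_lia.
case: (ltnP 3 n.+1) => n3; last first.
  have En : n = 2 by lia.
  by subst n; apply: triangulable3.
have step (a b c q : 'I_n.+1) : cyc a b c -> [set a; b] \notin F -> [set b; c] \notin F ->
    [set c; a] \notin F -> fan F a b -> fan F b c -> fan F c a -> cyc a q b ->
    triangulable F.
  move=> abc ab bc ca fab fbc fca aqb.
  have [x [xa xb xc sx]] : exists x, [/\ a != x, b != x, c != x & ~ spanned F x].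
    case: (fab) => H.
      exists (ordS a); split; try by (move: abc aqb; ord_lia).
      rewrite /spanned; have /eqP-> : ord_pred (ordS a) == a by ord_lia.
      have /orP[/eqP->|/H/negP//] : (ordS (ordS a) == b) || cyc a (ordS (ordS a)) b.
        by move: abc aqb; ord_lia.
      exact/negP.
    exists (ord_pred b); split; try by (move: abc aqb; ord_lia).
    rewrite /spanned setUC; have /eqP-> : ordS (ord_pred b) == b by ord_lia.
    have /orP[/eqP->|/H/negP//] :
        (ord_pred (ord_pred b) == a) || cyc a (ord_pred (ord_pred b)) b.
      by move: abc aqb; ord_lia.
    by rewrite setUC; apply/negP.
  apply: (ear_triangulable n3 dF sx).
  have [a' Ea] := unliftE xa; have [b' Eb] := unliftE xb; have [c' Ec] := unliftE xc.
  rewrite {}Ea {}Eb {}Ec in abc ab bc ca fab fbc fca.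
  rewrite -!(@delete_pair n.+1) in ab bc ca.
  apply: (IH _ a' b' c'); try exact: (@fan_delete n.+1); try by [].
    exact: (@delete_disjoint n.+1).
  by rewrite -(cyc_lift x).
have [t [tu tp tw]] := fourth_point u p w n3.
have : [|| cyc u t p, cyc p t w | cyc w t u] by move: tu tp tw upw; ord_lia.
case/or3P => H; first exact: (step u p w t).
  by apply: (step p w u t _ pw wu up fpw fwu fup H); move: upw; ord_lia.
by apply: (step w u p t _ wu up pw fwu fup fpw H); move: upw; ord_lia.
Qed.

(** The triangle consists of [u] and the next two vertices; the only non-empty arc is fanned from
    [u]. *)
Lemma isolated_triangulable n (F : {set {set 'I_n}}) (u : 'I_n) :
  2 < n -> [disjoint F & boundary n] -> (forall y, [set u; y] \notin F) ->
  triangulable F.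
Proof.
move=> n2 dF iso.
have bF y : [set y; ordS y] \notin F.
  by apply/negP => /(disjointFr dF); rewrite boundary_pair eqxx.
apply: (three_fan (u := u) (p := ordS u) (w := ordS (ordS u))) => //.
- ord_lia.
- by rewrite setUC.
- by left=> q _.
- left=> q; ord_lia.
- by right=> q _.
Qed.

(** In the triangle [u], [ordS s], [w], the first arc is fanned from [u], whose neighbours lie
    beyond [s], and the other two from [w], whose only possible neighbour [s] is on neither. *)
Lemma crossing_triangulable n (F : {set {set 'I_n}}) (u w s y0 : 'I_n) :
  [disjoint F & boundary n] -> cyc u s w ->
  (forall y, [set w; y] \in F -> y = s) ->
  (forall y, [set u; y] \in F -> cyc s y w) ->
  [set u; y0] \in F -> [set u; ordS s] \notin F -> triangulable F.
Proof.
move=> dF usw Nw Nu uy0 up; have sy0 := Nu _ uy0.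
have Nw' y : y != s -> [set w; y] \notin F.
  by apply: contraNN => /Nw ->.
have py0 : ordS s != y0 by apply: contraNneq up => ->.
apply: (three_fan (u := u) (p := ordS s) (w := w)) => //.
- by move: usw sy0 py0; ord_lia.
- by rewrite setUC Nw'; move: usw; ord_lia.
- by rewrite Nw'; move: usw; ord_lia.
- by left=> q uqp; apply/negP => /Nu; move: uqp usw; ord_lia.
- by right=> q pqw; apply: Nw'; move: pqw usw; ord_lia.
- by left=> q pqw; apply: Nw'; move: pqw usw; ord_lia.
Qed.

(** Mirror image of [crossing_triangulable], with [ord_pred s] as the middle corner. *)
Lemma crossing_triangulable_pred n (F : {set {set 'I_n}}) (u w s y0 : 'I_n) :
  [disjoint F & boundary n] -> cyc w s u ->
  (forall y, [set w; y] \in F -> y = s) ->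
  (forall y, [set u; y] \in F -> cyc w y s) ->
  [set u; y0] \in F -> [set u; ord_pred s] \notin F -> triangulable F.
Proof.
move=> dF usw Nw Nu uy0 up; have sy0 := Nu _ uy0.
have Nw' y : y != s -> [set w; y] \notin F.
  by apply: contraNN => /Nw ->.
have py0 : ord_pred s != y0 by apply: contraNneq up => ->.
apply: (three_fan (u := w) (p := ord_pred s) (w := u)) => //.
- by move: usw sy0 py0; ord_lia.
- by rewrite Nw'; move: usw; ord_lia.
- by rewrite setUC.
- by rewrite setUC Nw'; move: usw; ord_lia.
- by left=> q uqp; apply: Nw'; move: uqp usw; ord_lia.
- by right=> q uqp; apply/negP => /Nu; move: uqp usw; ord_lia.
- by right=> q pqw; apply: Nw'; move: pqw usw; ord_lia.
Qed.

(** In the triangle [u], [ordS u], [w], the arc up to [w] is fanned from [w] and the arc back to [u]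
    from [u]: each apex has its neighbours on the other side of the chord from [u] to [w]. *)
Lemma separated_triangulable n (F : {set {set 'I_n}}) (u w y0 : 'I_n) :
  [disjoint F & boundary n] -> 
  (forall y, [set u; y] \in F -> cyc u y w) ->
  (forall y, [set w; y] \in F -> cyc w y u) ->
  [set u; y0] \in F -> triangulable F.
Proof.
move=> dF Nu Nw uy0; have y0c := Nu _ uy0.
have bF y : [set y; ordS y] \notin F.
  by apply/negP => /(disjointFr dF); rewrite boundary_pair eqxx.
have py0 : ordS u != y0 by apply: contraNneq (bF u) => ->.
apply: (three_fan (u := u) (p := ordS u) (w := w)) => //.
- by move: y0c py0; ord_lia.
- by rewrite setUC; apply/negP => /Nw; move: y0c py0; ord_lia.
- by apply/negP => /Nw; ord_lia.
- by left=> q; ord_lia.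
- by right=> q uqp; apply/negP => /Nw; move: uqp y0c py0; ord_lia.
- by right=> q uqp; apply/negP => /Nu; move: uqp; ord_lia.
Qed.

(** * Graphs with few edges *)

Lemma card_cover_le n (F : {set {set 'I_n}}) :
  F \subset convex_complete n -> #|cover F| <= #|F|.*2.
Proof.
move=> /subsetP sF; apply: leq_trans (leq_card_cover F) _.
rewrite -muln2 -sum_nat_const leq_sum // => e /sF; rewrite inE => /eqP ->.
by [].
Qed.

(** With four vertices, opposite vertices are spanned by the same diagonal. *)
Lemma short_inj n (i j : 'I_n) : 4 < n ->
  [set ord_pred i; ordS i] = [set ord_pred j; ordS j] -> i = j.
Proof.
move=> n4 /set2_eq[] [/eqP a /eqP b]; apply/eqP; move: n4 a b; ord_lia.
Qed.

Lemma card_spanned n (F : {set {set 'I_n}}) (S : {set 'I_n}) : 4 < n ->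
  (forall x, x \in S -> spanned F x) -> #|S| <= #|F|.
Proof.
move=> n4 H; rewrite -(card_imset _ (fun i j => @short_inj _ i j n4)).
by apply/subset_leq_card/subsetP => e /imsetP[x /H ? ->].
Qed.

Lemma ordS_ind n (P : pred 'I_n) (x : 'I_n) :
  P x -> (forall y, P y -> P (ordS y)) -> forall y, P y.
Proof.
move=> Px PS y.
have H d (z : 'I_n) : z = (x + d) %% n :> nat -> P z.
  elim: d z => [|d IH] z; first by rewrite addn0 modn_small // => /val_inj ->.
  move=> zE; have n0 : 0 < n by case: (n) x {Px zE IH} => // -[].
  pose z' := Ordinal (ltn_pmod (x + d) n0).
  have -> : z = ordS z'.
    by apply: val_inj; rewrite /= zE addnS -[in RHS]addn1 modnDml addn1.
  exact/PS/IH.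
apply: (H (y + n - x)).
have -> : x + (y + n - x) = y + n by have := ltn_ord x; lia.
by rewrite modnDr modn_small.
Qed.

Lemma few_edges_triangulable n (F : {set {set 'I_n}}) :
  2 < n -> F \subset convex_complete n -> [disjoint F & boundary n] ->
  #|F| <= n - 3 -> triangulable F.
Proof.
elim: n F => // n IH F n2 sF dF cF.
have [[x iso]|niso] := classic (exists x, forall y, [set x; y] \notin F).
  exact: isolated_triangulable iso.
have {}niso x : exists y, [set x; y] \in F.
  apply: NNPP => H; apply: niso; exists x => y; apply/negP => xy; apply: H; by exists y.
(* On three or four vertices [F] has at most one edge, too few to leave no vertex isolated. *)
case: (leqP n.+1 4) => n4.
  have : #|cover F| = n.+1.
    apply/eqP; rewrite -[X in _ == X]card_ord -cardsT; apply/eqP/eq_card => x.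
    rewrite inE; have [y xy] := niso x.
    by apply/bigcupP; exists [set x; y]; rewrite ?set21.
  have := card_cover_le sF; lia.
(* Distinct spanned vertices need distinct edges, and there are fewer edges than vertices. Cutting
   off [x] then removes at least one edge, so the bound is inherited. *)
have [x sx] : exists x, ~ spanned F x.
  apply: NNPP => H; have := @card_spanned _ F setT n4; rewrite cardsT card_ord.
  suff: forall x, x \in [set: 'I_n.+1] -> spanned F x by move=> h /(_ h); lia.
  by move=> x _; apply: NNPP => h; apply: H; exists x.
apply: (ear_triangulable (x := x)) => //; first by lia.
apply: IH; [by lia|exact: (@delete_sub n.+1)|exact: (@delete_disjoint n.+1)|].
suff: 0 < deg F x by have := @card_delete n.+1 F x; move: #|_| => a -> ?; lia.
have [y xy] := niso x.
by apply/card_gt0P; exists [set x; y]; rewrite inE xy set21.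
Qed.

(** * Structure of the graphs whose removal destroys all triangulations *)

Definition lab (n : nat) (c : 'I_n) (i : nat) : 'I_n := iter i (@ordS n) c.

Lemma lab_val n (c : 'I_n) i : lab c i = (c + i) %% n :> nat.
Proof.
elim: i => [|i IH]; first by rewrite addn0 modn_small.
by rewrite /lab iterS /= -[iter i _ c]/(lab c i) IH -addn1 modnDml -addnA addn1.
Qed.

Lemma lab_periodic n (c : 'I_n) i : lab c (i + n) = lab c i.
Proof. by apply: ord_inj; rewrite !lab_val addnA modnDr. Qed.

Lemma ord_pred_lab n (c : 'I_n) i : ord_pred (lab c i.+1) = lab c i.
Proof. exact: ordSK. Qed.

Lemma lab_inj n (c : 'I_n) i j :
  lab c i = lab c j -> i < j + n -> j < i + n -> i = j.
Proof.
wlog ij : i j / i <= j => [H|].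
  by case: (leqP i j) => [|/ltnW] ? E ? ?; [|apply/esym]; apply: H.
move/(congr1 (@nat_of_ord n)); rewrite !lab_val => E _ lt; apply/eqP.
have : c + i + 0 == c + i + (j - i) %[mod n].
  by rewrite addn0 -addnA subnKC // E.
by rewrite eqn_modDl mod0n modn_small; lia.
Qed.

Lemma lab_onto n (c : 'I_n) a x : exists i, a <= i < a + n /\ lab c i = x.
Proof.
have n0 : 0 < n by have := ltn_ord c; lia.
elim: a => [|a [i [ia <-]]].
  exists ((x + n - c) %% n); split; first by rewrite ltn_pmod.
  apply: ord_inj; rewrite lab_val modnDmr subnKC ?modnDr ?modn_small //.
  by have := ltn_ord c; lia.
case: (ltngtP i a) => [|lt|ia']; [lia | by exists i; split; [lia|]|].
by exists (i + n); rewrite lab_periodic; split; [lia|].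
Qed.

(** * Degrees in terms of neighbours *)

Lemma deg_nbr n (F : {set {set 'I_n}}) x : F \subset convex_complete n ->
  deg F x = #|[set y | [set x; y] \in F]|.
Proof.
move=> /subsetP sF; rewrite -(card_imset (f := fun y => [set x; y])).
  apply: eq_card => e; apply/idP/imsetP => [|[y]]; rewrite !inE; last first.
    by move=> ? ->; rewrite set21 andbT.
  case/andP => eF; case/sF/edgeP: (eF) => a [b [ab E]]; rewrite E in eF *.
  by rewrite !inE => /orP[]/eqP ->; [exists b|exists a]; rewrite ?inE // setUC.
by move=> y z /set2_eq[[]|[]] // -> ->.
Qed.

Lemma pendantP n (F : {set {set 'I_n}}) x : F \subset convex_complete n ->
  deg F x = 1 <-> exists h, [set x; h] \in F /\ forall y, [set x; y] \in F -> y = h.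
Proof.
move=> sF; rewrite deg_nbr //; split=> [/eqP/cards1P[h E]|[h [xh H]]].
  exists h; split=> [|y xy]; first by move/setP/(_ h): E; rewrite in_set set11.
  by apply/set1P; rewrite -E in_set.
apply/eqP/cards1P; exists h; apply/setP => y; rewrite !inE.
by apply/idP/eqP => [/H|->].
Qed.

Lemma deg_gt0P n (F : {set {set 'I_n}}) x : F \subset convex_complete n ->
  0 < deg F x <-> exists y, [set x; y] \in F.
Proof.
move=> sF; rewrite deg_nbr //; split=> [/card_gt0P[y]|[y xy]].
  by rewrite inE; exists y.
by apply/card_gt0P; exists y; rewrite inE.
Qed.

Lemma deg_gt1P n (F : {set {set 'I_n}}) x : F \subset convex_complete n ->
  1 < deg F x <-> exists y z, [/\ [set x; y] \in F, [set x; z] \in F & y != z].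
Proof.
move=> sF; rewrite deg_nbr //; split=> [/card_gt1P[y [z []]]|[y [z [xy xz yz]]]].
  by rewrite !inE; exists y, z.
by apply/card_gt1P; exists y, z; rewrite !inE.
Qed.

Lemma deg_gt1_other n (F : {set {set 'I_n}}) x z : F \subset convex_complete n ->
  1 < deg F x -> exists2 y, [set x; y] \in F & y != z.
Proof.
move=> sF /(deg_gt1P _ sF)[y [y' [xy xy' yy']]].
case: (eqVneq y z) => [E|]; last by exists y.
by exists y' => //; rewrite -E eq_sym.
Qed.

Section NonTriangulable.

Variables (n : nat) (F : {set {set 'I_n}}).
Hypotheses (sF : F \subset convex_complete n) (dF : [disjoint F & boundary n]).
Hypothesis nt : ~ triangulable F.

Lemma no_boundary y : [set y; ordS y] \notin F.
Proof. by apply/negP => /(disjointFr dF); rewrite boundary_pair eqxx. Qed.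

Lemma edge_irrefl y : [set y; y] \notin F.
Proof. by apply/negP => /(subsetP sF); rewrite edge_pair eqxx. Qed.

Lemma nontriangulable_nbr x : 2 < n -> exists y, [set x; y] \in F.
Proof.
move=> n2; apply: NNPP => H; apply: nt; apply: (isolated_triangulable (u := x)) => // y.
by apply/negP => xy; apply: H; exists y.
Qed.

(** Otherwise [few_edges_triangulable] applies to the other [n - 1] vertices. So unspanned vertices
    have degree at most 1 when [F] has [n - 2] edges, and at most 2 when it has [n - 1]. *)
Lemma unspanned_deg_le x : 3 < n -> ~ spanned F x -> n - 3 <= #|F| - deg F x.
Proof.
move=> n3 sx; rewrite leqNgt; apply/negP => lt; apply: nt; apply: (ear_triangulable n3 dF sx).
apply: few_edges_triangulable; first lia.
- exact: delete_sub.
- by apply: delete_disjoint => //; lia.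
rewrite card_delete; move: lt n3; move: (_ - deg F x) => a; clear; lia.
Qed.

(** Otherwise [h] becomes isolated once the ear at [u] is cut off. *)
Lemma unspanned_hub u h : 3 < n -> ~ spanned F u -> [set u; h] \in F -> 1 < deg F h.
Proof.
move=> n3 su uh; apply/deg_gt1P => //.
case: (boolP [exists y, (y != u) && ([set h; y] \in F)]) => [/existsP[y /andP[yu hy]]|].
  by exists y, u; split=> //; rewrite setUC.
move=> /existsPn H; exfalso; apply: nt; apply: (ear_triangulable n3 dF su).
have hu : h != u by apply: contraTneq uh => ->; apply: edge_irrefl.
have [h' E] := unliftE hu.
apply: (isolated_triangulable (u := h')); [lia|by apply: delete_disjoint => //; lia|].
by move=> y; rewrite delete_pair -E; have := H (lift u y); rewrite eq_sym neq_lift.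
Qed.

Lemma crossing_hubs u w y z :
  (forall t, [set u; t] \in F -> t = y) -> (forall t, [set w; t] \in F -> t = z) ->
  [set u; y] \in F -> [set w; z] \in F -> crossing [set u; y] [set w; z] ->
  consecutive y z.
Proof.
move=> Nu Nw uy wz /crossingP/orP[]/andP[c1 c2].
  case: (eqVneq z (ordS y)) => [|ne]; first by left.
  exfalso; apply: nt; apply: (@crossing_triangulable _ _ w u y z) => //.
  - by move: c1 c2; ord_lia.
  - by move=> t /Nw ->; move: c1 c2; ord_lia.
  - by apply: contra ne => /Nw ->.
case: (eqVneq y (ordS z)) => [|ne]; first by right.
exfalso; apply: nt; apply: (@crossing_triangulable _ _ u w z y) => //.
- by move: c1 c2; ord_lia.
- by move=> t /Nu ->; move: c1 c2; ord_lia.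
- by apply: contra ne => /Nu ->.
Qed.

Hypotheses (n4 : 4 < n) (cF : #|F| < n).
Hypothesis pendF : forall x, ~ spanned F x -> deg F x = 1.

Let n2 : 2 < n. Proof. lia. Qed.
Let n3 : 3 < n. Proof. lia. Qed.

Lemma unspanned_hub_spanned u h : ~ spanned F u -> [set u; h] \in F -> spanned F h.
Proof.
move=> su uh; apply/negPn/negP => /negP sh.
by have := unspanned_hub n3 su uh; rewrite pendF.
Qed.

Lemma unspanned_nbr_unique u y z :
  ~ spanned F u -> [set u; y] \in F -> [set u; z] \in F -> y = z.
Proof. by move=> /pendF/(pendantP _ sF)[h [_ H]] /H -> /H ->. Qed.

(** If unspanned vertices were followed only by unspanned ones, no vertex would be spanned; yet the
    neighbour of an unspanned vertex is. *)
Lemma left_end_exists : exists u, ~ spanned F u /\ spanned F (ordS u).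
Proof.
have [u su] : exists u, ~ spanned F u.
  apply: NNPP => H; have := @card_spanned _ F setT n4; rewrite cardsT card_ord.
  suff h x : x \in [set: 'I_n] -> spanned F x by move/(_ h); lia.
  by move=> _; apply: NNPP => h; apply: H; exists x.
have [h uh] := nontriangulable_nbr u n2.
apply: NNPP => H; have : ~~ ([set ord_pred h; ordS h] \in F).
  apply: (@ordS_ind _ (fun x => [set ord_pred x; ordS x] \notin F) u).
    exact/negP.
  by move=> y /negP sy; apply/negP => sSy; apply: H; exists y.
by move/negP; apply; apply: unspanned_hub_spanned uh.
Qed.

(** The only edge at [u] is the diagonal spanning [ordS u], and likewise for [w], so
    [separated_triangulable] applies. *)
Lemma left_end_unique u w : ~ spanned F u -> spanned F (ordS u) ->
  ~ spanned F w -> spanned F (ordS w) -> u = w.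
Proof.
move=> su sSu sw sSw; apply/eqP/negPn/negP => uw.
have pS (x : 'I_n) : ord_pred (ordS x) = x by exact: ordSK.
have eu : [set u; ordS (ordS u)] \in F by rewrite -{1}(pS u).
have ew : [set w; ordS (ordS w)] \in F by rewrite -{1}(pS w).
have D (x y : 'I_n) : spanned F x -> ~ spanned F y -> x != y.
  by move=> sx sy; apply: contra_notN sy => /eqP <-.
have SSu := unspanned_hub_spanned su eu; have SSw := unspanned_hub_spanned sw ew.
apply: nt; apply: (@separated_triangulable _ _ u w (ordS (ordS u))) => //.
  move=> y /(unspanned_nbr_unique su eu) <-.
  by move: n2 (D _ _ SSu sw) (D _ _ sSu sw) uw; ord_lia.
move=> y /(unspanned_nbr_unique sw ew) <-.
by move: n2 (D _ _ SSw su) (D _ _ sSw su) uw; ord_lia.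
Qed.

Lemma spanned_run : exists (c : 'I_n) (k : nat),
  [/\ 2 <= k <= n - 2,
      (forall i, 1 <= i <= k -> spanned F (lab c i)) &
      (forall i, k < i <= n -> ~ spanned F (lab c i))].
Proof.
have [c [sc sSc]] := left_end_exists.
pose Q i := (0 < i) && ([set ord_pred (lab c i); ordS (lab c i)] \notin F).
have labn : lab c n = c by exact: (lab_periodic c 0).
have Qn : Q n by rewrite /Q labn; apply/andP; split; [lia|apply/negP].
have [k' /andP[k0 kQ] kmin] := ex_minnP (ex_intro _ n Qn).
have kn : k' <= n := kmin _ Qn.
have k1 : k' != 1 by apply: contraNneq kQ => ->.
have spk i : 1 <= i <= k'.-1 -> spanned F (lab c i).
  move=> ik; apply/negPn/negP => H; have /kmin : Q i by rewrite /Q H; lia.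
  by lia.
have nsp i : k' <= i <= n -> ~ spanned F (lab c i).
  elim: i => [|i IH] ik; first by lia.
  case: (eqVneq k' i.+1) => [<-|ne]; first exact/negP.
  move=> sSi; have si : ~ spanned F (lab c i) by apply: IH; lia.
  have E := left_end_unique si sSi sc sSc.
  by have := @lab_inj n c i n; rewrite E labn => /(_ erefl); lia.
exists c, k'.-1; split=> // [|i ik]; last by apply: nsp; lia.
have e1 : [set c; lab c 2] \in F.
  by have := spk 1; rewrite /spanned ord_pred_lab; apply; lia.
(* A run of length one would make [lab c 2], the neighbour of [c], unspanned. *)
have k2 : k' != 2.
  apply/eqP => k2; apply: (nsp 2); first by lia.
  exact: unspanned_hub_spanned e1.
(* If [c] were the only unspanned vertex, the diagonals spanning the two ends of the run would be
   two different edges at [c]. *)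
suff : k' != n by lia.
apply/eqP => kn'.
have e2 : [set c; lab c (n - 2)] \in F.
  have := spk (n - 1); rewrite /spanned; have -> : n - 1 = (n - 2).+1 by lia.
  rewrite ord_pred_lab -[ordS _]/(lab c (n - 2).+2).
  have -> : (n - 2).+2 = n by lia.
  by rewrite labn setUC; apply; lia.
have := unspanned_nbr_unique sc e1 e2; move/lab_inj; lia.
Qed.

End NonTriangulable.

Lemma consecutive_sym n (x y : 'I_n) : consecutive x y -> consecutive y x.
Proof. by case; [right|left]. Qed.

(* With [L i] the vertex reached from [c] after [i] boundary steps, the spanned
   vertices are [L 1], ..., [L k] and the others [L k.+1], ..., [L n] = [L 0].  The
   ends [L 1] and [L k] may be pendant, so the non-pendant vertices of the
   configuration can form a shorter arc than the spanned ones. *)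
Section ArcGraph.

Variables (n : nat) (G : {set {set 'I_n}}) (c : 'I_n) (k : nat).
Let L := lab c.
Hypotheses (n4 : 4 < n) (sG : G \subset convex_complete n) (cG : #|G| = n - 2).
Hypothesis (kn : 2 <= k <= n - 2).
Hypothesis short : forall i, 0 < i <= k -> [set L i.-1; L i.+1] \in G.
Hypothesis outer : forall i, k < i <= n -> deg G (L i) = 1.
Hypothesis hub : forall i y, k < i <= n -> [set L i; y] \in G ->
  exists j, 0 < j <= k /\ y = L j.
Hypothesis inner : forall i j, 0 < i -> i < j -> j <= k ->
  [set L i; L j] \in G -> j = i.+2.
Hypothesis hub2 : k = 2 -> 1 < deg G (L 1) /\ 1 < deg G (L 2).
Hypothesis cross : forall i j y z, k < i <= n -> k < j <= n ->
  [set L i; y] \in G -> [set L j; z] \in G -> crossing [set L i; y] [set L j; z] ->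
  consecutive y z.

Let Ln : L n = L 0.
Proof. exact: (lab_periodic c 0). Qed.

Let Linj i j : L i = L j -> i < j + n -> j < i + n -> i = j.
Proof. exact: lab_inj. Qed.

Let Lonto x : exists i, 0 < i < 1 + n /\ L i = x.
Proof. exact: lab_onto. Qed.

Let nbr_unique x y z : deg G x = 1 -> [set x; y] \in G -> [set x; z] \in G -> y = z.
Proof. by move=> /(pendantP _ sG)[h [_ H]] /H -> /H ->. Qed.

Let short_left i : 1 < i <= k -> [set L i; L (i - 2)] \in G.
Proof.
move=> ik; have := @short i.-1; rewrite setUC.
have -> : i.-1.-1 = i - 2 by lia.
have -> : i.-1.+1 = i by lia.
by apply; lia.
Qed.

Let short_right i : i < k -> [set L i; L i.+2] \in G.
Proof. by move=> ik; have := @short i.+1; apply. Qed.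

Let deg_inner i : 1 < i < k -> 1 < deg G (L i).
Proof.
move=> ik; apply/(deg_gt1P _ sG); exists (L (i - 2)), (L i.+2).
split; [apply: short_left; lia|apply: short_right; lia|].
by apply/eqP => /Linj; lia.
Qed.

Let deg_hub i y : k < i <= n -> [set L i; y] \in G -> 1 < deg G y.
Proof.
move=> ik iy; have [j [jk E]] := hub ik iy; subst y.
case: (ltngtP k 2) => [|k3|k2]; first by lia.
  case: (ltngtP j 1) => [|j1|j1]; first by lia.
    case: (ltngtP j k) => [jk'||jk']; [by apply: deg_inner; lia|by lia|].
    apply/(deg_gt1P _ sG); exists (L (j - 2)), (L i); split.
    - by apply: short_left; lia.
    - by rewrite setUC.
    - apply/eqP; case: (eqVneq i n) => [->|ne]; rewrite ?Ln => /Linj; lia.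
  subst j; apply/(deg_gt1P _ sG); exists (L 3), (L i); split.
  - by apply: short_right; lia.
  - by rewrite setUC.
  - apply/eqP => /Linj; lia.
have [h1 h2] := hub2 k2.
by have [->|->] : j = 1 \/ j = 2 by lia.
Qed.

Let arc_no_isolated : no_isolated G.
Proof.
move=> x; have [i [i1 <-]] := Lonto x.
case: (leqP i k) => ik; last by rewrite [deg _ _]outer //; lia.
apply/(deg_gt0P _ sG); case: (ltngtP i k) => [lt||E]; last 1 first.
- by exists (L (i - 2)); apply: short_left; lia.
- by exists (L i.+2); apply: short_right.
- lia.
Qed.

(** A neighbour other than [L 3] must be interior to the outer arc: the only edges at [L 0] and
    [L k.+1] are the diagonals spanning [L 1] and [L k]. This feeds the bound on the number of
    non-pendant vertices. *)
Let first_hub : 1 < deg G (L 1) -> exists p, k.+1 < p < n /\ [set L p; L 1] \in G.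
Proof.
case/(deg_gt1_other (L 3) sG) => y; have [p [p1 <-]] := Lonto y.
move=> e ne; exists p; split; last by rewrite setUC.
case: (leqP p k) => pk.
  case: (ltngtP p 1) => [|lt|E]; first by lia.
    by have := inner _ lt pk e; move=> /(_ isT) E; rewrite E eqxx in ne.
  by move: (edge_irrefl sG (L 1)); rewrite -{2}E e.
have p1' : p != k.+1.
  apply/eqP => E; subst p.
  have e' : [set L k.+1; L k.-1] \in G by rewrite setUC; apply: short; lia.
  rewrite setUC in e.
  have E := nbr_unique (outer _) e e'; case: (eqVneq k 2) => [k2|k2].
    by rewrite k2 eqxx in ne.
  have /Linj : L 1 = L k.-1 by apply: E; lia.
  lia.
have pn : p != n.
  apply/eqP => E; subst p; rewrite setUC in e.
  have e' : [set L n; L 2] \in G by rewrite Ln; apply: short_right; lia.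
  have /Linj : L 1 = L 2 by apply: (nbr_unique _ e e'); apply: outer; lia.
  lia.
lia.
Qed.

Let last_hub : 1 < deg G (L k) -> exists p, k.+1 < p < n /\ [set L p; L k] \in G.
Proof.
case/(deg_gt1_other (L (k - 2)) sG) => y; have [p [p1 <-]] := Lonto y.
move=> e ne; exists p; split; last by rewrite setUC.
case: (leqP p k) => pk.
  case: (ltngtP p k) => [lt||E]; [|by lia|]; last first.
    by move: (edge_irrefl sG (L k)); rewrite -{2}E e.
  rewrite setUC in e; have p0 : 0 < p by lia.
  by have E := inner p0 lt (leqnn k) e; move: ne; rewrite E !subSS subn0 eqxx.
have p1' : p != k.+1.
  apply/eqP => E; subst p.
  have e' : [set L k.+1; L k.-1] \in G by rewrite setUC; apply: short; lia.
  rewrite setUC in e.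
  have /Linj : L k = L k.-1 by apply: (nbr_unique _ e e'); apply: outer; lia.
  lia.
have pn : p != n.
  apply/eqP => E; subst p; rewrite setUC in e.
  have e' : [set L n; L 2] \in G by rewrite Ln; apply: short_right; lia.
  have /Linj : L k = L 2 by apply: (nbr_unique _ e e'); apply: outer; lia.
  move=> k2; have {}k2 : k = 2 by lia.
  by move: ne; rewrite k2 subnn Ln eqxx.
lia.
Qed.

Let pendant_outer_or_end i : 0 < i <= n -> pendant G (L i) ->
  [\/ k < i <= n, i = 1 /\ 2 < k | i = k /\ 2 < k].
Proof.
move=> i1 pi; case: (leqP i k) => ik; last by constructor 1; lia.
have : ~ (1 < i < k) by move=> /deg_inner; rewrite pi.
case: (ltngtP k 2) => k2 ni; [lia | |].
  by case: (ltngtP i 1) => ?; [lia|constructor 3; lia|constructor 2; lia].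
have [h1 h2] := hub2 k2.
by have [E|E] : i = 1 \/ i = 2 by [lia|]; subst i; rewrite pi in h1 h2.
Qed.

(** The only edge at a pendant end of the arc spans the adjacent inner vertex. An edge crossing it
    ends at that inner vertex, which is not pendant, hence equals [z]. *)
Let end_crossing i t y z : 0 < i <= k -> pendant G (L i) -> [set L i; y] \in G ->
  pendant G t -> [set t; z] \in G -> crossing [set L i; y] [set t; z] ->
  consecutive y z.
Proof.
move=> ik pi iy pt tz.
have npt j : 1 < j < k -> t != L j.
  by move=> /deg_inner d; apply: contraTneq d => <-; rewrite pt.
have in_i : 0 < i <= n by lia.
have [|[E k2]|[E k2]] := pendant_outer_or_end in_i pi; first by lia.
  have e : [set L 1; L 3] \in G by apply: short_right; lia.
  rewrite E in pi iy *; rewrite (nbr_unique pi iy e).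
  have -> : [set L 1; L 3] = [set ord_pred (L 2); ordS (L 2)] by rewrite ord_pred_lab.
  move/crossing_ear; rewrite !inE eq_sym (negbTE (npt 2 _)) /=; last by lia.
  by move/eqP <-; right.
have e : [set L k; L (k - 2)] \in G by apply: short_left; lia.
rewrite E in pi iy *; rewrite (nbr_unique pi iy e).
have -> : [set L k; L (k - 2)] = [set ord_pred (L k.-1); ordS (L k.-1)].
  have -> : k.-1 = (k - 2).+1 by lia.
  rewrite ord_pred_lab -[ordS _]/(L (k - 2).+2) setUC.
  by congr [set _; L _]; lia.
move/crossing_ear; rewrite !inE eq_sym (negbTE (npt k.-1 _)) /=; last by lia.
by move/eqP <-; left; have -> : k.-1 = (k - 2).+1 by lia.
Qed.

Let pendant_crossing t u y z : pendant G t -> pendant G u ->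
  [set t; y] \in G -> [set u; z] \in G -> crossing [set t; y] [set u; z] ->
  consecutive y z.
Proof.
have [i [i1 <-]] := Lonto t; have [j [j1 <-]] := Lonto u.
move=> pt pu ty uz X; case: (leqP i k) => ik.
  by apply: end_crossing X => //; lia.
case: (leqP j k) => jk; last by apply: cross X => //; lia.
apply: consecutive_sym; move/crossing_sym: X; apply: end_crossing => //; lia.
Qed.

Lemma arc_config_F : config_F G.
Proof.
split=> //; first by lia.
have d1 i : deg G (L i) = 1 \/ 1 < deg G (L i).
  by have := arc_no_isolated (L i); lia.
(* Here [L 2] is the only non-pendant vertex: [G] is its star together with the diagonal spanning
   it, which is case (a) labelled from [L 2]. *)
case: (boolP [&& k == 3, deg G (L 1) == 1 & deg G (L k) == 1])
  => [/and3P[/eqP k3 /eqP dL1 /eqP dLk]|ncase].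
  rewrite k3 in dLk; exists (fun i => L (i + 2)); split; first by left.
  left=> e; split=> [eG|].
    case: (edgeP (subsetP sG _ eG)) => x [y [xy E]]; subst e.
    have outE u v : forall i, k < i <= n -> L i = u -> [set u; v] \in G ->
        exists i, 2 <= i <= n - 2 /\ [set u; v] = [set L (0 + 2); L (i + 2)].
      move=> i ik <- uv; exists (i - 2); split; first by lia.
      have [j [jk E]] := hub ik uv; have := deg_hub ik uv; rewrite E => dj.
      have -> : j = 2.
        have : j <> 1 by move=> E1; rewrite E1 dL1 in dj.
        have : j <> 3 by move=> E1; rewrite E1 dLk in dj.
        lia.
      by rewrite setUC; congr [set _; L _]; lia.
    have [i [i1 Ei]] := Lonto x; have [j [j1 Ej]] := Lonto y.
    case: (ltnP k i) => i3; first by left; apply: (outE x y i) => //; lia.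
    case: (ltnP k j) => j3.
      by left; rewrite setUC; apply: (outE y x j); rewrite 1?setUC //; lia.
    right; have -> : n - 1 + 2 = 1 + n by lia.
    rewrite /L lab_periodic; rewrite -Ei -Ej in eG xy *.
    case: (ltngtP i j) => ij.
    - have i0 : 0 < i by lia.
      have E := inner i0 ij j3 eG; have [-> ->] : i = 1 /\ j = 3 by lia.
      by rewrite setUC.
    - have j0 : 0 < j by lia.
      rewrite setUC in eG; have E := inner j0 ij i3 eG.
      by have [-> ->] : i = 3 /\ j = 1 by lia.
    - by rewrite ij eqxx in xy.
  case=> [[i [i2 ->]]|->].
    have ik : k < i + 2 <= n by lia.
    have [y iy] : exists y, [set L (i + 2); y] \in G.
      by apply/(deg_gt0P _ sG); rewrite outer.
    have [j [jk E]] := hub ik iy; have := deg_hub ik iy; move: iy; rewrite E => iy dj.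
    have j2 : j = 2.
      have : j <> 1 by move=> E1; rewrite E1 dL1 in dj.
      have : j <> 3 by move=> E1; rewrite E1 dLk in dj.
      lia.
    by rewrite j2 setUC in iy.
  have -> : n - 1 + 2 = 1 + n by lia.
  have k1 : 1 < k by lia.
  by rewrite [L (1 + n)]lab_periodic setUC; exact: (short_right k1).
(* [a] and [b] record whether [L 1] and [L k] are pendant. *)
have [a [a1 Ea]] : exists a,
    a <= 1 /\ (a = 0 -> 1 < deg G (L 1)) /\ (a = 1 -> pendant G (L 1)).
  by case: (d1 1) => d; [exists 1|exists 0].
have [b [b1 Eb]] : exists b,
    b <= 1 /\ (b = 0 -> 1 < deg G (L k)) /\ (b = 1 -> pendant G (L k)).
  by case: (d1 k) => d; [exists 1|exists 0].
have [Ea0 Ea1] := Ea; have [Eb0 Eb1] := Eb; move=> {Ea Eb}.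
have k2 : k = 2 -> a = 0 /\ b = 0.
  move=> k2; have [h1 h2] := hub2 k2; split.
    have: a <> 1 by move=> /Ea1 E; rewrite E in h1.
    lia.
  have: b <> 1 by move=> /Eb1; rewrite k2 => E; rewrite E in h2.
  lia.
have ab : k = 3 -> a = 1 -> b = 1 -> False.
  by move=> k3 /Ea1 E1 /Eb1 Ek; case/negP: ncase; apply/and3P; split; apply/eqP.
(* This bounds the number [k - a - b] of non-pendant vertices by [n - 4]. Each non-pendant end has a
   neighbour inside the outer arc, and two such neighbours differ because outer vertices are
   pendant. *)
have count : 4 <= n - k + a + b.
  case: (posnP a) => a0; case: (posnP b) => b0; last by lia.
  - have [p [pk pE]] := first_hub (Ea0 a0); have [q [qk qE]] := last_hub (Eb0 b0).
    suff : p <> q by lia.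
    move=> E; rewrite E in pE.
    have /Linj : L 1 = L k by apply: (nbr_unique _ pE qE); apply: outer; lia.
    lia.
  - have [p [pk pE]] := first_hub (Ea0 a0); lia.
  - have [p [pk pE]] := last_hub (Eb0 b0); lia.
have degv t : a < t <= k - b -> 1 < deg G (L t).
  move=> tk; case: (ltngtP t 1) => [|t1|E]; [lia| |by subst t; apply: Ea0; lia].
  case: (ltngtP t k) => [tk'||E]; [|lia|by subst t; apply: Eb0; lia].
  by apply: deg_inner; lia.
(* A pendant [L 1] is counted after the outer arc, as [L n.+1]. *)
have pendv t : k - b < t <= n + a -> pendant G (L t).
  move=> tk; case: (leqP t n) => tn; last first.
    have -> : t = 1 + n by lia.
    by rewrite /L lab_periodic; apply: Ea1; lia.
  case: (leqP t k) => tk'; last by apply: outer; lia.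
  have -> : t = k by lia.
  by apply: Eb1; lia.
have hubv t y : pendant G t -> [set t; y] \in G -> 1 < deg G y.
  have [i [i1 <-]] := Lonto t; move=> pi iy.
  have i_n : 0 < i <= n by lia.
  case: (pendant_outer_or_end i_n pi) => [ik|[E k3]|[E k3]].
  - exact: deg_hub iy.
  - have e : [set L 1; L 3] \in G by apply: short_right; lia.
    rewrite E in pi iy; rewrite (nbr_unique pi iy e); apply: degv.
    have : a <> 0 by move/Ea0; rewrite pi.
    lia.
  - have e : [set L k; L (k - 2)] \in G by apply: short_left; lia.
    rewrite E in pi iy; rewrite (nbr_unique pi iy e); apply: degv.
    have : b <> 0 by move/Eb0; rewrite pi.
    lia.
exists (fun i => L (i + a.+1)); split; first by left.
right; exists (k - a - b); split; first by lia.
- move=> i ik; split; first by apply: degv; lia.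
  have -> : i + n.-1 + a.+1 = (i + a) + n by lia.
  rewrite [L (_ + n)]lab_periodic.
  have -> : i.+1 + a.+1 = (i + a).+2 by lia.
  by apply: short_right; lia.
- move=> i ik; split; first by apply: pendv; lia.
  move=> y iy py; have := hubv _ _ (pendv (i + a.+1) _) iy; rewrite py.
  have ia : k - b < i + a.+1 <= n + a by lia.
  by move=> H; have := H ia; rewrite ltnn.
- move=> t u i j im jm pt pu ti uj X.
  have lt i' s : i' < n -> pendant G s -> [set s; L (i' + a.+1)] \in G -> i' < k - a - b.
    move=> i'n ps si; rewrite ltnNge; apply/negP => ge.
    by have := hubv _ _ ps si; rewrite [deg _ _]pendv //; lia.
  have ik := lt i t im pt ti; have jk := lt j u jm pu uj.
  have [] := pendant_crossing pt pu ti uj X; rewrite -[ordS _]/(L (_ + a.+1).+1) => /Linj.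
    by right; lia.
  by left; lia.
Qed.

End ArcGraph.

(** * Extraction of a configuration from [F] *)

Section UnspannedPendant.

Variables (n : nat) (F : {set {set 'I_n}}).
Hypotheses (sF : F \subset convex_complete n) (dF : [disjoint F & boundary n]).
Hypothesis nt : ~ triangulable F.
Hypotheses (n4 : 4 < n) (cF : #|F| < n).
Hypothesis pendF : forall x, ~ spanned F x -> deg F x = 1.

Let n2 : 2 < n. Proof. lia. Qed.
Let n3 : 3 < n. Proof. lia. Qed.

Lemma config_F_subgraph : exists G : {set {set 'I_n}},
  [/\ G \subset F, #|G| = n - 2 & config_F G].
Proof.
have [c [k [kn spL nspL]]] := spanned_run sF dF nt n4 cF pendF.
pose L := lab c.
have Linj i j : L i = L j -> i < j + n -> j < i + n -> i = j by exact: lab_inj.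
have Lonto x : exists i, 0 < i < 1 + n /\ L i = x by exact: lab_onto.
have Ln : L n = L 0 by exact: (lab_periodic c 0).
have [hub hubP] : exists f : 'I_n -> 'I_n, forall x, [set x; f x] \in F.
  (* The default [x] is never taken, since no vertex is isolated. *)
  exists (fun x => odflt x [pick y | [set x; y] \in F]) => x.
  case: pickP => [y //|H]; have [y] := nontriangulable_nbr dF nt x n2.
  by rewrite H.
(* [phi] maps the n - 2 vertices other than [L 1] and [L k] injectively to edges;
   the diagonals spanning [L 1] and [L k] are already the edges at the unspanned
   vertices [L 0] and [L k.+1]. *)
pose sp x := [set ord_pred x; ordS x] \in F.
pose phi x := if sp x then [set ord_pred x; ordS x] else [set x; hub x].
have phiF x : phi x \in F by rewrite /phi; case: ifP.
have L1k : L 1 != L k by apply/eqP => /Linj; nat_lia.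
pose G := phi @: ~: [set L 1; L k].
have GF : G \subset F by apply/subsetP => e /imsetP[x _ ->].
have sG : G \subset convex_complete n := subset_trans GF sF.
have nspE i : k < i <= n -> sp (L i) = false by move=> ik; apply/negP; apply: nspL.
have spE i : 0 < i <= k -> sp (L i) by exact: spL.
have n0 : ~ spanned F (L 0) by rewrite -Ln; apply: nspL; nat_lia.
have phiL i : phi (L i.+1) =
    if sp (L i.+1) then [set L i; L i.+2] else [set L i.+1; hub (L i.+1)].
  by rewrite /phi ord_pred_lab.
have touchG u y : ~ spanned F u -> [set u; y] \in F -> [set u; y] \in G.
  move=> su uy; apply/imsetP; exists u; last first.
    rewrite /phi /sp; case: ifP => // _; congr [set _; _].
    exact: (unspanned_nbr_unique sF pendF su).
  by rewrite !inE; apply/norP; split; apply: contra_notN su => /eqP ->; apply: spL; nat_lia.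
have cardG : #|G| = n - 2.
  rewrite card_in_imset.
    by have := cardsC [set L 1; L k]; rewrite card_ord cards2 L1k; nat_lia.
  (* The edge chosen at an unspanned vertex has an unspanned end, while a diagonal spanning an inner
     vertex of the arc joins two spanned vertices. *)
  have mixed x y : x \in ~: [set L 1; L k] -> sp x -> ~~ sp y -> phi x = phi y -> False.
    have [i [i1 <-]] := Lonto x; rewrite !inE => /norP[x1 xk] sx nsy.
    have ik : i <= k by rewrite leqNgt; apply/negP => ki; rewrite nspE // in sx; nat_lia.
    have i1' : i != 1 by apply: contraNneq x1 => ->.
    have ik' : i != k by apply: contraNneq xk => ->.
    move=> /setP/(_ y); rewrite [in RHS]/phi (negbTE nsy) set21.
    have -> : i = i.-1.+1 by nat_lia.
    rewrite phiL spE; last by nat_lia.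
    by rewrite !inE => /orP[]/eqP E; move: nsy; rewrite E spE; nat_lia.
  move=> x y xJ yJ E; case sx: (sp x); case sy: (sp y).
  - by move: E; rewrite /phi sx sy; apply: short_inj.
  - by case: (mixed x y); rewrite ?sy.
  - by case: (mixed y x); rewrite ?sx.
  - move: E; rewrite /phi sx sy => /set2_eq[[]|[] // E _].
      by [].
    have := unspanned_hub_spanned sF dF nt n4 cF pendF (elimF idP sy) (hubP y).
    by rewrite -E /spanned -/(sp x) sx.
exists G; split=> //.
have shortG i : 0 < i <= k -> [set L i.-1; L i.+1] \in G.
  move=> ik; have sF' : [set L i.-1; L i.+1] \in F.
    have iE : i = i.-1.+1 by nat_lia.
    by have := spL i ik; rewrite /spanned {1}iE ord_pred_lab.
  case: (eqVneq i 1) => [i1|i1]; first by subst i; apply: touchG.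
  case: (eqVneq i k) => [ik'|ik'].
    subst i; rewrite setUC; apply: touchG; last by rewrite setUC.
    by apply: nspL; nat_lia.
  apply/imsetP; exists (L i).
    by rewrite !inE; apply/norP; split; apply/eqP => /Linj; nat_lia.
  have -> : i = i.-1.+1 by nat_lia.
  by rewrite phiL spE //; nat_lia.
have outerG i : k < i <= n -> deg G (L i) = 1.
  move=> ik; have si := nspL i ik; apply/(pendantP _ sG); exists (hub (L i)).
  split=> [|y /(subsetP GF) H]; first exact: touchG.
  exact: (unspanned_nbr_unique sF pendF si H).
have hubG i y : k < i <= n -> [set L i; y] \in G -> exists j, 0 < j <= k /\ y = L j.
  move=> ik /(subsetP GF) iy; have [j [j1 E]] := Lonto y; exists j; split=> //.
  have := unspanned_hub_spanned sF dF nt n4 cF pendF (nspL i ik) iy; rewrite -E => sj.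
  by case: (leqP j k) => jk; [nat_lia|case: (nspL j _ sj); nat_lia].
have innerG i j : 0 < i -> i < j -> j <= k -> [set L i; L j] \in G -> j = i.+2.
  move=> i0 ij jk /imsetP[x _]; have [t [t1 <-]] := Lonto x.
  have -> : t = t.-1.+1 by nat_lia.
  rewrite phiL; case: ifP => [st|/negP st]; last first.
    move=> E; have : L t.-1.+1 \in [set L i; L j] by rewrite E set21.
    by rewrite !inE => /orP[]/eqP E'; case: st; rewrite E' spE //; nat_lia.
  have tk : t <= k.
    rewrite leqNgt; apply/negP => kt; have tn : k < t <= n by nat_lia.
    by move: st; have <- : t = t.-1.+1 by [nat_lia|]; rewrite nspE.
  by case/set2_eq => -[/Linj Ei /Linj Ej]; move: Ei Ej; nat_lia.
have crossG i j y z : k < i <= n -> k < j <= n ->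
    [set L i; y] \in G -> [set L j; z] \in G -> crossing [set L i; y] [set L j; z] ->
    consecutive y z.
  move=> ik jk /(subsetP GF) iy /(subsetP GF) jz.
  apply: (crossing_hubs dF nt) => // t H.
    exact: (unspanned_nbr_unique sF pendF (nspL i ik) H iy).
  exact: (unspanned_nbr_unique sF pendF (nspL j jk) H jz).
have hub2G : k = 2 -> 1 < deg G (L 1) /\ 1 < deg G (L 2).
  move=> k2.
  (* An edge of [F] without unspanned ends could only join [L 1] to [L 2], a boundary edge. So the
     degree bound of [unspanned_hub] transfers from [F] to [G]. *)
  have EG : F = G.
    apply/eqP; rewrite eq_sym eqEsubset GF /=; apply/subsetP => e eF.
    case: (edgeP (subsetP sF _ eF)) => x [y [xy E]]; subst e.
    have [i [i1 Ei]] := Lonto x; have [j [j1 Ej]] := Lonto y; subst x y.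
    case: (leqP i k) => ik; last by apply: touchG => //; apply: nspL; nat_lia.
    case: (leqP j k) => jk; last first.
      by rewrite setUC; apply: touchG; [apply: nspL; nat_lia|rewrite setUC].
    have ij : i != j by apply: contraNneq xy => ->.
    have := no_boundary dF (L 1); have : (i = 1 /\ j = 2) \/ (i = 2 /\ j = 1) by nat_lia.
    by case=> -[Ei Ej]; subst i j => /negP[] //; rewrite setUC.
  have h u y : ~ spanned F u -> [set u; y] \in F -> 1 < deg F y.
    exact: (unspanned_hub sF dF nt n3).
  rewrite -EG; split.
    apply: (h (L 3)); first by apply: nspL; nat_lia.
    have := shortG 2; rewrite -EG setUC; apply; nat_lia.
  apply: (h (L 0)) => //; have := shortG 1; rewrite -EG; apply; nat_lia.
exact: (@arc_config_F n G c k).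
Qed.

End UnspannedPendant.

(** Treated separately because [short_inj], and with it the arc argument, requires five vertices. *)
Lemma quadrilateral_config_F (F : {set {set 'I_4}}) :
  F \subset convex_complete 4 -> [disjoint F & boundary 4] -> #|F| = 2 -> config_F F.
Proof.
move=> sF dF cF.
have sub : F \subset [set [set inord 0; inord 2]; [set inord 1; inord 3]].
  apply/subsetP => e eF; case: (edgeP (subsetP sF _ eF)) => x [y [xy E]]; subst e.
  move: (disjointFr dF eF); rewrite boundary_pair => /negbT/norP[b1 b2].
  have : (x == 0 :> nat) && (y == 2 :> nat) || (x == 2 :> nat) && (y == 0 :> nat) ||
    (x == 1 :> nat) && (y == 3 :> nat) || (x == 3 :> nat) && (y == 1 :> nat).
    by move: xy b1 b2; ord_lia.
  case/orP => [/orP[/orP[]|]|] /andP[/eqP Ex /eqP Ey];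
    rewrite -[x]inord_val -[y]inord_val Ex Ey.
  - by rewrite set21.
  - by rewrite setUC set21.
  - by rewrite set22.
  - by rewrite setUC set22.
have FE : F = [set [set inord 0; inord 2]; [set inord 1; inord 3]].
  apply/eqP; rewrite eqEcard sub cF cards2 /=.
  by case: (_ != _).
have labE i : i < 4 -> lab (inord 0 : 'I_4) i = inord i.
  by move=> i4; apply: ord_inj; rewrite lab_val !inordK // add0n modn_small.
split=> // [x|].
  apply/(deg_gt0P _ sF); rewrite FE.
  have [i [i1 <-]] := lab_onto (inord 0) 0 x; rewrite labE //.
  case: i i1 => [|[|[|[|i]]]] // _.
  - by exists (inord 2); rewrite set21.
  - by exists (inord 3); rewrite set22.
  - by exists (inord 0); rewrite setUC set21.
  - by exists (inord 1); rewrite setUC set22.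
exists (lab (inord 0)); split; first by left.
left=> e; rewrite FE !labE //; split=> [/set2P[]->|[[i [i2 ->]]|->]].
- by left; exists 2; rewrite labE.
- by right.
- by have -> : i = 2 by [lia|]; rewrite labE // set21.
- by rewrite set22.
Qed.

Lemma nontriangulable_config_F n (F : {set {set 'I_n}}) :
  4 <= n -> F \subset convex_complete n -> [disjoint F & boundary n] ->
  #|F| = n - 2 -> ~ triangulable F -> config_F F.
Proof.
move=> n3 sF dF cF nt; case: (leqP n 4) => n4.
  have En : n = 4 by lia.
  by subst n; apply: quadrilateral_config_F.
have pendF x : ~ spanned F x -> deg F x = 1.
  move=> sx; have := unspanned_deg_le sF dF nt n3 sx; rewrite cF.
  have [y xy] := nontriangulable_nbr dF nt x (ltnW n3).
  have : 0 < deg F x by apply/(deg_gt0P _ sF); exists y.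
  lia.
have cF' : #|F| < n by lia.
have [G [GF cG]] := config_F_subgraph sF dF nt n4 cF' pendF.
by have /eqP -> : G == F by rewrite eqEcard GF cG cF /=.
Qed.

Theorem theorem3 (n : nat) (F : {set {set 'I_n}}) :
  5 <= n ->
  F \subset convex_complete n ->
  #|F| = n - 1 ->
  [disjoint F & boundary n] ->
  ~ (J_type1 F \/ J_type2 F) ->
  admits_triangulation (convex_complete n :\: F).
Proof.
move=> n4 sF cF dF nJ; apply: NNPP => nt; apply: nJ.
have n3 : 3 < n by lia.
have deg_pos x : 0 < deg F x.
  apply/(deg_gt0P _ sF); apply: (nontriangulable_nbr dF nt); lia.
have deg_le x : ~ spanned F x -> deg F x <= 2.
  by move=> sx; have := unspanned_deg_le sF dF nt n3 sx; rewrite cF; lia.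
(* Deleting an unspanned vertex of degree 2 leaves [n - 3] edges on [n - 1] vertices, as in
   [nontriangulable_config_F]. *)
have JF : config_J F.
  split=> // x sx; split=> [|dx]; first exact: deg_le.
  apply: nontriangulable_config_F; [lia|exact: delete_sub|apply: delete_disjoint => //; lia| |].
    by rewrite card_delete cF dx; lia.
  by move=> tx; apply: nt; apply: (ear_triangulable n3 dF sx).
case: (classic (exists x, in_J F 2 x)) => [ex2|nex2]; [right|left].
  split=> // x y1 y2 t s [dx sx] ney xy1 xy2 pt ts X1 X2.
  have Nt y : [set t; y] \in F -> y = s.
    by move: pt => /(pendantP _ sF)[h [_ H]] /H ->; rewrite (H _ ts).
  have Nx y : [set x; y] \in F -> y = y1 \/ y = y2.
    move=> xy; case: (eqVneq y y1) => [|e1]; first by left.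
    case: (eqVneq y y2) => [|e2]; first by right.
    have : 2 < deg F x; last by rewrite dx.
    rewrite deg_nbr //; apply: leq_trans (subset_leq_card (_ : [set y; y1; y2] \subset _)).
      by rewrite setUC cardsU1 cards2 !inE e1 negb_or eq_sym e2 eq_sym ney.
    by apply/subsetP => z; rewrite !inE => /orP[/orP[]|] /eqP ->.
  apply: NNPP => /not_or_and[nc1 nc2]; apply: nt.
  move: X1 X2 => /crossing_sym/crossingP X1 /crossing_sym/crossingP X2.
  (* Both [y1] and [y2] lie across the chord from [t] to [s], seen from [x]; the side of [x] selects
     one of the two mirror-image lemmas. *)
  case: (boolP (cyc x s t)) => st.
    apply: (@crossing_triangulable _ _ x t s y1) => //.
    - by move=> y /Nx[]->; move: X1 X2 st; ord_lia.
    - by apply/negP => /Nx[] E; [apply: nc1|apply: nc2]; right.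
  apply: (@crossing_triangulable_pred _ _ x t s y1) => //.
  - by move: X1 st; ord_lia.
  - by move=> y /Nx[]->; move: X1 X2 st; ord_lia.
  - have SP : ordS (ord_pred s) = s by exact: ord_predK.
    by apply/negP => /Nx[] E; [apply: nc1|apply: nc2]; left; rewrite -E SP.
split=> //.
  by move=> x jx; apply: nex2; exists x.
have pendF x : ~ spanned F x -> deg F x = 1.
  move=> sx; have := deg_le x sx; have := deg_pos x.
  have : deg F x <> 2 by move=> dx; apply: nex2; exists x.
  lia.
have cF' : #|F| < n by lia.
have [G [GF cG GJ]] := config_F_subgraph sF dF nt n4 cF' pendF.
(* The edge required by Type-1 is the one edge of [F] outside [G]. *)
have [e E] : exists e, F :\: G = [set e].
  by apply/cards1P; rewrite cardsD (setIidPr GF) cF cG; apply/eqP; lia.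
exists e; split.
  by have := set11 e; rewrite -E inE => /andP[].
by rewrite -E setDDr setDv set0U (setIidPr GF); exact: GJ.
Qed.
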